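(* Consider the Random Apollonian Network process, and let $Z_k(t)$ denote the number of vertices of degree $k$ after $t$ steps, $k \geq 3$. For any $k \geq 3$ there exists a constant $b_k$ (depending on $k$) such that for $t$ sufficiently large $$ |\mathbb{E}[Z_k(t)] - b_k t| \leq K, \quad\text{where } K=3.6.$$ Furthermore, let $\lambda>0$. For any $k \geq 3$, $$\Pr\big(|Z_k(t) - \mathbb{E}[Z_k(t)]| \geq \lambda\big) \leq 2e^{-\frac{\lambda^2}{72t}}.$$
   Context: A Random Apollonian Network (RAN) is generated as follows: start (at time $t=0$) with a single triangular face (a triangle in the plane). At each step $t=1,2,\dots$, pick one of the current (bounded) triangular faces uniformly at random, insert a new vertex inside it, and connect the new vertex to the three vertices on the boundary of that face; this subdivides the chosen face into three new triangular faces. Thus after $t$ steps there are $2t+1$ triangular faces. $Z_k(t)$ is the (random) number of vertices of degree exactly $k$ in the graph after $t$ steps. *)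

(* Defs.v *)
From mathcomp Require Import all_boot all_order all_algebra.
From mathcomp Require Import all_classical all_reals all_analysis.
Set Implicit Arguments. Unset Strict Implicit. Unset Printing Implicit Defensive.
Import Order.TTheory GRing.Theory Num.Theory.
Local Open Scope ring_scope.

(* Random Apollonian Network.
   Vertices are natural numbers; the initial triangle has vertices 0,1,2 and
   the vertex inserted at step i (1-based) is numbered i+2.
   A state records the list of current (bounded) triangular faces, the list of
   edges (as unordered pairs stored once each) and the number of vertices. *)
Record ran_state := RanState {
  ran_faces : seq (nat * nat * nat);
  ran_edges : seq (nat * nat);
  ran_nverts : nat }.

Definition ran_init : ran_state :=
  RanState [:: (0, 1, 2)]%N [:: (0, 1); (1, 2); (0, 2)]%N 3.

Definition ran_step (st : ran_state) (i : nat) : ran_state :=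
  let: (a, b, c) := nth (0, 0, 0)%N (ran_faces st) i in
  let v := ran_nverts st in
  RanState (take i (ran_faces st) ++ [:: (a, b, v); (a, v, c); (v, b, c)]
              ++ drop i.+1 (ran_faces st))
           [:: (a, v), (b, v), (c, v) & ran_edges st]
           v.+1.

Definition ran_run (s : seq nat) : ran_state := foldl ran_step ran_init s.

(* All possible choice sequences for t steps: at step i (0-based) there are
   2i+1 faces, and index j < 2i+1 is chosen.  The uniform distribution on this
   list (each sequence has probability 1 / prod_(i<t) (2i+1)) is exactly the
   law of the RAN process after t steps. *)
Fixpoint ran_choices (t : nat) : seq (seq nat) :=
  match t with
  | 0 => [:: [::]]
  | t'.+1 => [seq rcons s j | s <- ran_choices t', j <- iota 0 (2 * t').+1]
  end.

Definition ran_degree (st : ran_state) (v : nat) : nat :=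
  count (fun e : nat * nat => (e.1 == v) || (e.2 == v)) (ran_edges st).

Definition Zk (k : nat) (s : seq nat) : nat :=
  let st := ran_run s in
  count (fun v => ran_degree st v == k) (iota 0 (ran_nverts st)).

Definition EZk (R : realType) (k t : nat) : R :=
  (\sum_(s <- ran_choices t) (Zk k s)%:R) / (size (ran_choices t))%:R.

Definition ran_prob (R : realType) (t : nat) (E : pred (seq nat)) : R :=
  (count E (ran_choices t))%:R / (size (ran_choices t))%:R.

(* Main.v *)
Require Import Defs.
From mathcomp Require Import all_boot all_order all_algebra.
From mathcomp Require Import all_classical all_reals all_analysis.
From mathcomp Require Import zify ring lra.
Set Implicit Arguments. Unset Strict Implicit. Unset Printing Implicit Defensive.
Import Order.TTheory GRing.Theory Num.Theory.
Import numFieldNormedType.Exports.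
Local Open Scope ring_scope.

(* A vertex gains an edge exactly when one of the bounded faces around it is
   chosen. An inner vertex of degree d lies on d of the n = 2t+1 faces, so the
   expected number y_k(t) of inner vertices of degree k satisfies
     y_k(t+1) = (1 - k/n) y_k(t) + ((k-1)/n) y_(k-1)(t) + [k = 3].
   With b_k = 24 / (k (k+1) (k+2)), the deviations y_k(t) - b_k (t + 1/2) satisfy
   the homogeneous recurrence, whose coefficients are nonnegative with sum at
   most 1 once n >= k; for smaller n almost all y_k(t) vanish. This bounds the
   deviations by 1/2, and the three outer vertices contribute between 0 and 3.

   For the concentration, the conditional expectation of Z_k(t) given the first
   steps is a sum over the present vertices of a probability depending only on
   the number of faces at the vertex, plus a deterministic contribution of
   future vertices. One step alters the three vertices of the chosen face, so
   the martingale increments are at most 6 and Azuma's inequality applies. *)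

(** * Hoeffding's lemma for finite averages *)

Lemma leq_expn2_fact_fact_double n : (2 ^ n * n`! <= n.*2`!)%N.
Proof.
elim: n => // n IHn; rewrite doubleS !factS expnS.
have -> : (2 * 2 ^ n * (n.+1 * n`!) = n.*2.+2 * (2 ^ n * n`!))%N by lia.
by rewrite leq_pmul2l // (leq_trans IHn) // leq_pmull.
Qed.

(** The odd terms of the two series cancel, and the even ones compare termwise because
    [2^n n! <= (2n)!]. *)
Lemma series_exp_coeff_cosh_le (R : realType) (y : R) n :
  series (exp_coeff y) n.*2 + series (exp_coeff (- y)) n.*2 <=
  2 * series (exp_coeff (y ^+ 2 / 2)) n.
Proof.
rewrite /series /= /exp_coeff /=; elim: n => [|n IHn].
  by rewrite !big_nil mulr0 addr0.
rewrite doubleS !big_nat_recr //= [(- y) ^+ n.*2.+1]exprNn.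
rewrite [(- y) ^+ n.*2]exprNn -[(-1) ^+ n.*2]signr_odd.
rewrite -[(-1) ^+ n.*2.+1]signr_odd /= odd_double /= expr0 expr1 mul1r.
rewrite mulrDr.
set A := \sum_(_ <= _ < _) _ in IHn *; set B := \sum_(_ <= _ < _) _ in IHn *.
have H : y ^+ n.*2 / n.*2`!%:R <= (y ^+ 2 / 2) ^+ n / n`!%:R.
  rewrite -mul2n exprM expr_div_n -mulrA -invfM ler_wpM2l //.
    by rewrite exprn_ge0 // sqr_ge0.
  rewrite lef_pV2 ?posrE ?ltr0n ?mulr_gt0 ?exprn_gt0 ?ltr0n ?fact_gt0//.
  by rewrite -natrX -natrM ler_nat mul2n leq_expn2_fact_fact_double.
rewrite mulN1r mulNr.
by lra.
Qed.

Section CoshBound.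
Local Open Scope classical_set_scope.
Local Open Scope ring_scope.

Lemma cosh_le_expR_sqr (R : realType) (y : R) :
  expR y + expR (- y) <= 2 * expR (y ^+ 2 / 2).
Proof.
have dbl : (fun n => n.*2) @ \oo --> \oo.
  move=> A [N _ NA]; exists N => // n /= Nn; apply: NA => /=.
  by rewrite -addnn (leq_trans Nn) // leq_addr.
have cv (x : R) : series (exp_coeff x) @ \oo --> expR x.
  exact: is_cvg_series_exp_coeff.
have cv2 (x : R) : series (exp_coeff x) n.*2 @[n --> \oo] --> expR x.
  exact: cvg_comp dbl (cv x).
have l1 : series (exp_coeff y) n.*2 + series (exp_coeff (- y)) n.*2
    @[n --> \oo] --> expR y + expR (- y) by apply: cvgD; exact: cv2.
have l2 : 2 * series (exp_coeff (y ^+ 2 / 2)) n @[n --> \oo] -->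
    2 * expR (y ^+ 2 / 2) by apply: cvgMl_tmp; exact: cv.
apply: (ler_cvg_to l1 l2); near=> n => /=.
exact: series_exp_coeff_cosh_le.
Unshelve. all: by end_near. Qed.

End CoshBound.

(** Convexity: [y * u] is the mean of [y] and [- y] with weights [(1 + u) / 2] and [(1 - u) / 2]. *)
Lemma expR_chord_le (R : realType) (y u : R) : -1 <= u <= 1 ->
  expR (y * u) <= (expR y + expR (- y)) / 2 + u * ((expR y - expR (- y)) / 2).
Proof.
move=> /andP[u1 u2].
have t01 : 0 <= (1 + u) / 2 <= 1 by apply/andP; split; lra.
have := convex_expR (Itv01 (andP t01).1 (andP t01).2) y (- y).
rewrite !convRE /= /unstable.onem.
have -> : (1 + u) / 2 * y + (1 - (1 + u) / 2) * (- y) = y * u by field.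
lra.
Qed.

(** Expectations are finite averages throughout; [EZk] is convertible to one. *)
Definition avg (R : realType) (I : Type) (r : seq I) (f : I -> R) : R :=
  (\sum_(i <- r) f i) / (size r)%:R.

Section Average.
Variables (R : realType) (I : eqType) (r : seq I).
Implicit Types (f g : I -> R) (c : R).

Lemma eq_avg f g : {in r, f =1 g} -> avg r f = avg r g.
Proof. by move=> fg; rewrite /avg; congr (_ / _); apply: eq_big_seq. Qed.

Lemma le_avg f g : {in r, forall i, f i <= g i} -> avg r f <= avg r g.
Proof.
move=> fg; rewrite /avg ler_wpM2r ?invr_ge0 //.
by rewrite big_seq [leRHS]big_seq ler_sum.
Qed.

Lemma avgD f g : avg r (fun i => f i + g i) = avg r f + avg r g.
Proof. by rewrite /avg big_split mulrDl. Qed.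

Lemma avgMr f c : avg r (fun i => f i * c) = avg r f * c.
Proof. by rewrite /avg -mulr_suml mulrAC. Qed.

Lemma avg_cst c : (0 < size r)%N -> avg r (fun=> c) = c.
Proof.
move=> r0; rewrite /avg big_const_seq count_predT iter_addr_0 -[c *+ _]mulr_natr mulfK //.
by rewrite pnatr_eq0 -lt0n.
Qed.

Lemma avg_sum (J : Type) (q : seq J) (F : J -> I -> R) :
  avg r (fun i => \sum_(j <- q) F j i) = \sum_(j <- q) avg r (F j).
Proof. by rewrite /avg exchange_big mulr_suml. Qed.

(** Bounding the exponential by its chord leaves the constant [cosh (th * c)] and a linear term,
    which averages to zero. *)
Lemma hoeffding_avg f c (th : R) : (0 < size r)%N -> 0 < c ->
  avg r f = 0 -> {in r, forall i, `|f i| <= c} ->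
  avg r (fun i => expR (th * f i)) <= expR (th ^+ 2 * c ^+ 2 / 2).
Proof.
move=> r0 c0 f0 fc; pose y := th * c.
have chord : {in r, forall i, expR (th * f i) <= (expR y + expR (- y)) / 2 +
     f i * ((expR y - expR (- y)) / 2 / c)}.
  move=> i ir; have := fc i ir; rewrite ler_norml => /andP[f1 f2].
  have -> : th * f i = y * (f i / c) by rewrite /y; field; rewrite gt_eqF.
  apply: (le_trans (expR_chord_le _ _)).
    by rewrite ler_pdivlMr // ler_pdivrMr // mulN1r mul1r f1.
  by rewrite le_eqVlt; apply/orP; left; apply/eqP; field; rewrite gt_eqF.
apply: (le_trans (le_avg chord)).
rewrite avgD (avgMr f) f0 mul0r addr0 avg_cst // -exprMn.
by rewrite ler_pdivrMr // mulrC cosh_le_expR_sqr.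
Qed.

End Average.

(** * Averages over choice sequences *)

Lemma ran_choicesS t : ran_choices t.+1 =
  [seq rcons s j | s <- ran_choices t, j <- iota 0 (2 * t).+1].
Proof. by []. Qed.

(** The tower rule: every prefix has the same number [2t + 1] of extensions, so the inner average is
    the conditional expectation given the prefix. *)
Lemma avg_ran_choicesS (R : realType) t (f : seq nat -> R) :
  avg (ran_choices t.+1) f = avg (ran_choices t)
    (fun s => avg (iota 0 (2 * t).+1) (fun j => f (rcons s j))).
Proof.
rewrite /avg ran_choicesS big_allpairs_dep size_allpairs size_iota natrM -mulr_suml.
by rewrite -mulrA -invfM [X in _ / X]mulrC.
Qed.

Lemma ran_probE (R : realType) t (P : pred (seq nat)) :
  ran_prob R t P = avg (ran_choices t) (fun s => (P s)%:R).
Proof.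
rewrite /ran_prob /avg -sum1_count natr_sum big_mkcond /=; congr (_ / _).
by apply: eq_bigr => s _; case: (P s).
Qed.

Lemma size_ran_choices_gt0 t : (0 < size (ran_choices t))%N.
Proof.
elim: t => // t IHt.
by rewrite ran_choicesS size_allpairs size_iota muln_gt0 IHt.
Qed.

(** * Azuma's inequality *)

Section Azuma.
Variables (R : realType) (T : nat) (M : nat -> seq nat -> R) (c : R).
Hypothesis c_gt0 : 0 < c.
Hypothesis martingaleM : forall i s, (i < T)%N -> s \in ran_choices i ->
  avg (iota 0 (2 * i).+1) (fun j => M i.+1 (rcons s j)) = M i s.
Hypothesis incrM : forall i s j, (i < T)%N -> s \in ran_choices i ->
  (j < (2 * i).+1)%N -> `|M i.+1 (rcons s j) - M i s| <= c.

Lemma martingale_avg i : (i <= T)%N -> avg (ran_choices i) (M i) = M 0 [::].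
Proof.
elim: i => [|i IHi] iT; first by rewrite /avg /= big_seq1 divr1.
rewrite avg_ran_choicesS -IHi ?(ltnW iT) //.
by apply: eq_avg => s si; rewrite martingaleM.
Qed.

(** Given the prefix, the last increment has mean zero and is bounded by [c], so each step costs one
    Hoeffding factor. *)
Lemma martingale_mgf_le (th : R) i : (i <= T)%N ->
  avg (ran_choices i) (fun s => expR (th * (M i s - M 0 [::]))) <=
  expR (th ^+ 2 * c ^+ 2 / 2 * i%:R).
Proof.
elim: i => [|i IHi] iT.
  by rewrite /avg /= big_seq1 subrr !mulr0 expR0 divr1.
rewrite avg_ran_choicesS -[i.+1%:R]natr1 mulrDr mulr1 expRD.
apply: le_trans (ler_wpM2r (expR_ge0 _) (IHi (ltnW iT))); rewrite -avgMr.
apply: le_avg => s si.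
pose D j := M i.+1 (rcons s j) - M i s.
have -> : avg (iota 0 (2 * i).+1)
      (fun j => expR (th * (M i.+1 (rcons s j) - M 0 [::]))) =
    avg (iota 0 (2 * i).+1) (fun j => expR (th * D j)) *
      expR (th * (M i s - M 0 [::])).
  rewrite -avgMr; apply: eq_avg => j _; rewrite -expRD /D; congr expR; ring.
rewrite [leRHS]mulrC ler_wpM2r ?expR_ge0 //.
apply: hoeffding_avg => //.
- by rewrite avgD avg_cst // martingaleM // subrr.
- by move=> j; rewrite mem_iota add0n => /andP[_ ji]; exact: incrM.
Qed.

Lemma azuma_upper (lambda : R) : (0 < T)%N -> 0 < lambda ->
  ran_prob R T (fun s => lambda <= M T s - M 0 [::]) <=
  expR (- (lambda ^+ 2 / (2 * c ^+ 2 * T%:R))).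
Proof.
move=> T0 l0; have T0' : 0 < T%:R :> R by rewrite ltr0n.
(* This minimises the Chernoff exponent [th^2 c^2 T / 2 - th * lambda]. *)
pose th : R := lambda / (c ^+ 2 * T%:R).
have th0 : 0 < th by rewrite divr_gt0 // mulr_gt0 // exprn_gt0.
rewrite ran_probE.
(* Markov's inequality: the exponential of [th] times the excess over [lambda] dominates the
   indicator. *)
apply: (@le_trans _ _ (avg (ran_choices T)
    (fun s => expR (th * (M T s - M 0 [::])) * expR (- (th * lambda))))).
  apply: le_avg => s _; rewrite -expRD -mulrBr.
  case: (lerP lambda) => [h|_]; last exact: expR_ge0.
  by rewrite -expR0 ler_expR mulr_ge0 ?subr_ge0 ?(ltW th0).
rewrite avgMr; apply: le_trans (ler_wpM2r (expR_ge0 _) (martingale_mgf_le _ _)) _ => //.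
rewrite -expRD ler_expR le_eqVlt; apply/orP; left; apply/eqP.
by rewrite /th; field; rewrite !gt_eqF.
Qed.

End Azuma.

Lemma azuma (R : realType) (T : nat) (M : nat -> seq nat -> R) (c lambda : R) :
  (0 < T)%N -> 0 < c -> 0 < lambda ->
  (forall i s, (i < T)%N -> s \in ran_choices i ->
    avg (iota 0 (2 * i).+1) (fun j => M i.+1 (rcons s j)) = M i s) ->
  (forall i s j, (i < T)%N -> s \in ran_choices i ->
    (j < (2 * i).+1)%N -> `|M i.+1 (rcons s j) - M i s| <= c) ->
  ran_prob R T (fun s => lambda <= `|M T s - M 0 [::]|) <=
  2 * expR (- (lambda ^+ 2 / (2 * c ^+ 2 * T%:R))).
Proof.
move=> T0 c0 l0 mart incr.
have up := azuma_upper c0 mart incr T0 l0.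
(* The lower tail is the upper tail of the martingale [- M]. *)
have lo : ran_prob R T (fun s => lambda <= - M T s - - M 0 [::]) <=
    expR (- (lambda ^+ 2 / (2 * c ^+ 2 * T%:R))).
  apply: (@azuma_upper R T (fun i s => - M i s)) => // [i s iT si|i s j iT si ji].
    rewrite -mart // -[in RHS]mulN1r mulrC -avgMr.
    by apply: eq_avg => j _; rewrite mulrN1.
  by rewrite -opprD normrN; exact: incr.
rewrite [2]mulr2n mulrDl mul1r; apply: le_trans (lerD up lo).
rewrite !ran_probE -avgD; apply: le_avg => s _.
rewrite -opprD -normrN; case: (lerP 0 (M T s - M 0 [::])) => h.
  by rewrite normrN ger0_norm // lerDl.
by rewrite gtr0_norm ?oppr_gt0 // lerDr.
Qed.

(** * Faces and degrees along the process *)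

Definition in_face (v : nat) (f : nat * nat * nat) : bool :=
  let: (a, b, c) := f in [|| v == a, v == b | v == c].

Definition face_degree (st : ran_state) (v : nat) : nat :=
  count (in_face v) (ran_faces st).

Definition proper_face (n : nat) (f : nat * nat * nat) : bool :=
  let: (a, b, c) := f in
  [&& a != b, a != c, b != c, (a < n)%N, (b < n)%N & (c < n)%N].

Definition chosen_face (st : ran_state) (i : nat) : nat * nat * nat :=
  nth (0, 0, 0)%N (ran_faces st) i.

(* An outer vertex of degree d lies on d - 1 bounded faces, an inner one on d. *)
Record ran_invariant (t : nat) (st : ran_state) : Prop := RanInvariant {
  size_ran_faces : size (ran_faces st) = (2 * t).+1;
  ran_nvertsE : ran_nverts st = (3 + t)%N;
  proper_faces : all (proper_face (ran_nverts st)) (ran_faces st);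
  face_degree_ge : forall v, (ran_nverts st <= v)%N -> face_degree st v = 0%N;
  ran_degree_ge : forall v, (ran_nverts st <= v)%N -> ran_degree st v = 0%N;
  ran_degreeE : forall v, (v < ran_nverts st)%N ->
    ran_degree st v = (face_degree st v + (v < 3))%N }.

Lemma proper_chosen_face t st i : ran_invariant t st -> (i < (2 * t).+1)%N ->
  proper_face (ran_nverts st) (chosen_face st i).
Proof.
by move=> inv it; apply: (allP (proper_faces inv)); rewrite mem_nth ?(size_ran_faces inv).
Qed.

(** Each corner of the chosen face loses that face and lies on two of the three new ones, a net gain
    of one; the new vertex lies on all three. *)
Lemma face_degree_step t st i v : ran_invariant t st -> (i < (2 * t).+1)%N ->
  face_degree (ran_step st i) v =
  if v == ran_nverts st then 3%N
  else (face_degree st v + in_face v (chosen_face st i))%N.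
Proof.
move=> inv it; have := proper_chosen_face inv it.
have fd0 := face_degree_ge inv (leqnn _); move: fd0.
have isz : (i < size (ran_faces st))%N by rewrite (size_ran_faces inv).
have fE w : face_degree st w = (count (in_face w) (take i (ran_faces st)) +
   (in_face w (chosen_face st i) + count (in_face w) (drop i.+1 (ran_faces st))))%N.
  rewrite /face_degree -{1}(cat_take_drop i (ran_faces st)) count_cat.
  by rewrite (drop_nth (0, 0, 0)%N) //=.
rewrite !fE /ran_step -/(chosen_face st i).
case: (chosen_face st i) => [[a b] c] /=; set n := ran_nverts st => fd0.
rewrite /face_degree /= !count_cat /=.
case/and5P => ab ac bc an /andP[bn cn].
case: (eqVneq v n) => [->|vn].
  (* By [fd0] the fresh label occurs in no old face. *)
  have [/eqP -> /eqP] : count (in_face n) (take i (ran_faces st)) == 0%N /\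
    count (in_face n) (drop i.+1 (ran_faces st)) == 0%N by lia.
  move=> ->.
  by rewrite !orbT.
case: (eqVneq v a) => [->|va]; first by rewrite (negPf ab) (negPf ac) /=; lia.
case: (eqVneq v b) => [->|vb]; first by rewrite (negPf bc) /=; lia.
case: (eqVneq v c) => [->|vc] /=; lia.
Qed.

(** The increments agree with those of [face_degree_step], so the difference between the two degrees
    of an old vertex is constant in time. *)
Lemma ran_degree_step t st i v : ran_invariant t st -> (i < (2 * t).+1)%N ->
  ran_degree (ran_step st i) v =
  if v == ran_nverts st then 3%N
  else (ran_degree st v + in_face v (chosen_face st i))%N.
Proof.
move=> inv it; have := proper_chosen_face inv it.
have := ran_degree_ge inv (leqnn _).
rewrite /ran_step -/(chosen_face st i).
case: (chosen_face st i) => [[a b] c] /=; set n := ran_nverts st => d0.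
rewrite /ran_degree /= -/(ran_degree st v).
case/and5P => ab ac bc an /andP[bn cn].
rewrite [a == v]eq_sym [b == v]eq_sym [c == v]eq_sym [n == v]eq_sym.
case: (eqVneq v n) => [->|vn]; first by rewrite d0 !orbT.
rewrite !orbF.
case: (eqVneq v a) => [->|va]; first by rewrite (negPf ab) (negPf ac) /=; lia.
case: (eqVneq v b) => [->|vb]; first by rewrite (negPf bc) /=; lia.
case: (eqVneq v c) => [->|vc] /=; lia.
Qed.

Lemma ran_nverts_step st i : ran_nverts (ran_step st i) = (ran_nverts st).+1.
Proof. by rewrite /ran_step; case: nth => [[a b] c]. Qed.

Lemma in_face_lt n v f : proper_face n f -> in_face v f -> (v < n)%N.
Proof.
case: f => [[a b] c] /and5P[_ _ _ an /andP[bn cn]] /=.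
by case/or3P => /eqP ->.
Qed.

Lemma ran_invariant_init : ran_invariant 0 ran_init.
Proof. by split => //; case=> [|[|[|v]]]. Qed.

Lemma ran_invariant_step t st i : ran_invariant t st -> (i < (2 * t).+1)%N ->
  ran_invariant t.+1 (ran_step st i).
Proof.
move=> inv it; have pf := proper_chosen_face inv it.
have out v : (ran_nverts st < v)%N -> in_face v (chosen_face st i) = false.
  by move=> nv; apply/negP => /(in_face_lt pf); rewrite ltnNge ltnW.
split; rewrite ?ran_nverts_step.
- rewrite /ran_step -/(chosen_face st i); case: chosen_face => [[a b] c] /=.
  rewrite size_cat /= size_take size_drop (size_ran_faces inv) it; lia.
- by rewrite (ran_nvertsE inv) addnS.
- have pfs : all (proper_face (ran_nverts st).+1) (ran_faces st).
    apply: sub_all (proper_faces inv) => -[[a b] c] /=.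
    by case/and5P=> -> -> -> an /andP[bn cn] /=; rewrite (leqW an) (leqW bn) (leqW cn).
  rewrite /ran_step -/(chosen_face st i); move: pf.
  case: chosen_face => [[a b] c] /=.
  case/and5P => ab ac bc an /andP[bn cn].
  rewrite -(cat_take_drop i (ran_faces st)) all_cat in pfs.
  have /andP[p1 p2] := pfs.
  rewrite all_cat p1 /= ab bc ac ltnSn (leqW an) (leqW bn) (leqW cn).
  rewrite !(ltn_eqF an) !(ltn_eqF bn) !(gtn_eqF bn) !(gtn_eqF cn) /=.
  by move: p2; rewrite (drop_nth (0, 0, 0)%N) ?(size_ran_faces inv) // => /andP[].
- move=> v nv; rewrite (face_degree_step _ inv it) gtn_eqF // out //.
  by rewrite (face_degree_ge inv) // ltnW.
- move=> v nv; rewrite (ran_degree_step _ inv it) gtn_eqF // out //.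
  by rewrite (ran_degree_ge inv) // ltnW.
- move=> v; rewrite ltnS leq_eqVlt.
  rewrite (face_degree_step _ inv it) (ran_degree_step _ inv it).
  case: eqVneq => [-> _|vn /= vlt]; first by rewrite (ran_nvertsE inv).
  by rewrite (ran_degreeE inv) // addnAC.
Qed.

Lemma ran_run_rcons s j : ran_run (rcons s j) = ran_step (ran_run s) j.
Proof. by rewrite /ran_run foldl_rcons. Qed.

Lemma ran_invariant_run t s : s \in ran_choices t -> ran_invariant t (ran_run s).
Proof.
elim: t s => [|t IHt] s.
  by rewrite inE => /eqP ->; exact: ran_invariant_init.
move=> /allpairsP[[s' j] [s't jt ->]].
have : j \in iota 0 (2 * t).+1 := jt; rewrite mem_iota add0n => /andP[_ {}jt].
by rewrite ran_run_rcons /=; apply: ran_invariant_step => //; exact: IHt.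
Qed.

(** * The recurrence for the expected degree counts *)

(* The solution of [b k * (k + 2) = b k.-1 * (k - 1)] with [b 3 = 2 / 5]. *)
Definition degree_slope (R : realType) (k : nat) : R :=
  24 / (k%:R * (k.+1)%:R * (k.+2)%:R).

(** With [n = 2t + 1], this is what makes [degree_slope R k * (n / 2)] solve the recurrence exactly
    for degrees above 3. *)
Lemma degree_slope_rec (R : realType) k : (0 < k)%N ->
  degree_slope R k.+1 * (k.+1 + 2)%:R = degree_slope R k * k%:R.
Proof.
move=> k0; rewrite /degree_slope.
have h0 : (k%:R : R) != 0 by rewrite pnatr_eq0 -lt0n.
have h1 : (k%:R + 1 : R) != 0 by rewrite natr1 pnatr_eq0.
have h2 : (k%:R + 2 : R) != 0 by rewrite -natrD pnatr_eq0 addn2.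
have h3 : (k%:R + 3 : R) != 0 by rewrite -natrD pnatr_eq0 addn3.
rewrite -[k.+3]addn3 -[k.+2]addn2 -[k.+1]addn1 -addnA !natrD.
by field; rewrite ?h0 ?h1 ?h2 ?h3 ?andbT.
Qed.

Lemma degree_slope_ge0 (R : realType) k : 0 <= degree_slope R k.
Proof. by rewrite /degree_slope divr_ge0 ?mulr_ge0. Qed.

Lemma degree_slope_le_fifth (R : realType) k : (4 <= k)%N ->
  degree_slope R k <= 1 / 5.
Proof.
move=> k4; rewrite /degree_slope -!natrM ler_pdivrMr ?ltr0n; last by nia.
suff : (120%:R : R) <= (k * k.+1 * k.+2)%:R by lra.
by rewrite ler_nat; nia.
Qed.

Section DegreeRecurrence.
Variables (R : realType) (y : nat -> nat -> R).
Hypothesis y0 : forall k, y k 0 = 0.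
Hypothesis yS : forall k t, y k t.+1 =
  (1 - k%:R / (2 * t).+1%:R) * y k t +
  (k.-1)%:R / (2 * t).+1%:R * y k.-1 t + (k == 3)%:R.

Lemma degree_rec_small k t : (k <= 2)%N -> y k t = 0.
Proof.
elim: t k => [|t IHt] k k2; first exact: y0.
rewrite yS !IHt ?(leq_trans (leq_pred _)) // !mulr0 addr0 add0r.
by case: eqP => // k3; rewrite k3 in k2.
Qed.

(** The source enters at degree 3 and a step raises degrees by at most one, so after [t] steps only
    degrees up to [t + 2] occur. *)
Lemma degree_rec_early k t : (3 + t <= k)%N -> y k t = 0.
Proof.
elim: t k => [|t IHt] k tk; first exact: y0.
rewrite yS !IHt; try lia.
by rewrite !mulr0 addr0 add0r gtn_eqF //; lia.
Qed.

Let dev k t := y k t - degree_slope R k * ((2 * t).+1%:R / 2).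

Let devS k t : (4 <= k)%N -> dev k t.+1 =
  (1 - k%:R / (2 * t).+1%:R) * dev k t + (k.-1)%:R / (2 * t).+1%:R * dev k.-1 t.
Proof.
case: k => // k k4; rewrite /dev yS /= gtn_eqF // addr0.
have := degree_slope_rec R (leq_trans (isT : 0 < 3)%N k4).
set b := degree_slope R k.+1; set b' := degree_slope R k => e.
have n0 : ((2 * t).+1%:R : R) != 0 by rewrite pnatr_eq0.
have -> : ((2 * t.+1).+1%:R : R) = (2 * t).+1%:R + 2 by rewrite -natrD; congr _%:R; lia.
move: n0 e; rewrite natrD -[k.+1%:R]natr1; move: (_.+1%:R) => n n0 e.
(* Collecting the product [b' * k%:R] lets [e] eliminate [b']. *)
have -> : (1 - (k%:R + 1) / n) * (y k.+1 t - b * (n / 2)) +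
    k%:R / n * (y k t - b' * (n / 2)) =
    (1 - (k%:R + 1) / n) * (y k.+1 t - b * (n / 2)) +
    k%:R / n * y k t - b' * k%:R / 2 by field.
by rewrite -e; field.
Qed.

Let dev_early k t : (3 + t <= k)%N -> `|dev k t| <= 1 / 2.
Proof.
move=> tk; have k3 : (3 <= k)%N by lia.
rewrite /dev degree_rec_early // sub0r normrN.
rewrite ger0_norm ?mulr_ge0 ?degree_slope_ge0 // /degree_slope -!natrM.
rewrite mulrAC ler_pdivrMr ?ltr0n; last by nia.
suff : (24 * (2 * t).+1)%:R <= (k * k.+1 * k.+2)%:R :> R by rewrite natrM; lra.
rewrite ler_nat; nia.
Qed.

(** There is no inflow from degree 2, and the source 1 is exactly the growth [b_3 = 2/5] plus the
    outflow [3 b_3 / 2 = 3/5]. *)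
Let dev3S t : dev 3 t.+1 = (1 - 3 / (2 * t).+1%:R) * dev 3 t.
Proof.
rewrite /dev yS /= (@degree_rec_small 2) // mulr0 addr0.
have n0 : ((2 * t).+1%:R : R) != 0 by rewrite pnatr_eq0.
have -> : ((2 * t.+1).+1%:R : R) = (2 * t).+1%:R + 2.
  by rewrite -natrD; congr _%:R; lia.
rewrite /degree_slope; move: n0; move: (_%:R) => n n0.
by field.
Qed.

Let dev31 : dev 3 1 = 2 / 5.
Proof. by rewrite dev3S /dev y0 /degree_slope; field. Qed.

(** The factor [1 - 3 / n] vanishes at [t = 1], where [n = 3], and kills the deviation for good. *)
Let dev3_eq0 t : (2 <= t)%N -> dev 3 t = 0.
Proof.
case: t => [|[|t]] // _; elim: t => [|t IHt]; last by rewrite dev3S IHt mulr0.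
by rewrite dev3S; apply/eqP; rewrite mulf_eq0 subr_eq0 divff ?eqxx.
Qed.

Let dev_le k t : (3 <= k)%N -> `|dev k t| <= 1 / 2.
Proof.
elim: t k => [|t IHt] k k3; first exact: dev_early.
have [tk|tk] := leqP (3 + t.+1) k; first exact: dev_early.
case: (eqVneq k 3%N) => [->|k_neq3].
  case: t IHt tk => [|t] IHt tk; last by rewrite dev3_eq0 // normr0.
  by rewrite dev31 ger0_norm; lra.
have k4 : (4 <= k)%N by rewrite ltn_neqAle eq_sym k_neq3.
have [kN|Nk] := leqP k (2 * t).+1; last first.
  (* The only case with a negative coefficient and a nonzero count; here the deviation equals 1/2,
     so the bound is attained. *)
  have [-> ->] : k = 4%N /\ t = 1%N by lia.
  rewrite devS //= dev31 /dev degree_rec_early //.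
  have -> : (2 * 1).+1 = 3%N by [].
  by rewrite /degree_slope ger0_norm; lra.
rewrite devS //; have := IHt k k3; have := IHt k.-1 ltac:(lia).
rewrite !ler_norml => /andP[a1 a2] /andP[b1 b2].
have n0 : (0 : R) < (2 * t).+1%:R by rewrite ltr0n.
have u0 : 0 <= 1 - k%:R / (2 * t).+1%:R :> R.
  by rewrite subr_ge0 ler_pdivrMr // mul1r ler_nat.
have v0 : 0 <= k.-1%:R / (2 * t).+1%:R :> R by rewrite divr_ge0.
have uv : k.-1%:R / (2 * t).+1%:R <= k%:R / (2 * t).+1%:R :> R.
  by rewrite ler_pM2r ?invr_gt0 // ler_nat leq_pred.
move: u0 v0 uv; move: (k.-1%:R / _) (k%:R / _) => v u u0 v0 uv.
by apply/andP; split; nra.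
Qed.

(** Passing from [t + 1/2] to [t] adds [b_k / 2], at most 1/10 for [k >= 4]; for [k = 3] the
    deviation is zero once [t >= 2]. *)
Lemma degree_rec_linear k t : (3 <= k)%N -> (2 <= t)%N ->
  - (1 / 2) <= y k t - degree_slope R k * t%:R <= 6 / 10.
Proof.
move=> k3 t2.
have -> : y k t - degree_slope R k * t%:R = dev k t + degree_slope R k / 2.
  by rewrite /dev -natr1 natrM; field.
case: (eqVneq k 3%N) => [->|k_neq3].
  by rewrite dev3_eq0 // /degree_slope; lra.
have k4 : (4 <= k)%N by rewrite ltn_neqAle eq_sym k_neq3.
have := dev_le t k3; rewrite ler_norml.
have := degree_slope_le_fifth R k4; have := degree_slope_ge0 R k.
lra.
Qed.

End DegreeRecurrence.

(** * One-step averages of sums over vertices *)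

Lemma avg_in_face (R : realType) t st v : ran_invariant t st ->
  avg (iota 0 (2 * t).+1) (fun j => (in_face v (chosen_face st j))%:R) =
  (face_degree st v)%:R / (2 * t).+1%:R :> R.
Proof.
move=> inv; rewrite /avg size_iota; congr (_ / _).
rewrite /face_degree -sum1_count natr_sum [RHS]big_mkcond (big_nth (0, 0, 0)%N).
rewrite /index_iota subn0 (size_ran_faces inv).
by apply: eq_bigr => j _; rewrite /chosen_face; case: in_face.
Qed.

(** [F] may depend on the label because the counts below treat the outer vertices 0, 1, 2
    separately. *)
Lemma vertex_sum_step (R : realType) t st j (F : nat -> nat -> R) :
  ran_invariant t st -> (j < (2 * t).+1)%N ->
  \sum_(v <- iota 0 (ran_nverts (ran_step st j)))
     F v (face_degree (ran_step st j) v) =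
  \sum_(v <- iota 0 (ran_nverts st))
     F v (face_degree st v + in_face v (chosen_face st j))%N +
  F (ran_nverts st) 3%N.
Proof.
move=> inv jt; rewrite ran_nverts_step -addn1 iotaD big_cat big_seq1 add0n /=.
congr (_ + _); last by rewrite (face_degree_step _ inv jt) eqxx.
apply: eq_big_seq => v; rewrite mem_iota add0n => /andP[_ vn].
by rewrite (face_degree_step _ inv jt) ltn_eqF.
Qed.

(* A vertex on d of the n faces gains an edge with probability d / n. *)
Lemma avg_vertex_sum_step (R : realType) t st (F : nat -> nat -> R) :
  ran_invariant t st ->
  avg (iota 0 (2 * t).+1) (fun j =>
    \sum_(v <- iota 0 (ran_nverts (ran_step st j)))
       F v (face_degree (ran_step st j) v)) =
  \sum_(v <- iota 0 (ran_nverts st))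
     ((face_degree st v)%:R / (2 * t).+1%:R * F v (face_degree st v).+1 +
      (1 - (face_degree st v)%:R / (2 * t).+1%:R) * F v (face_degree st v)) +
  F (ran_nverts st) 3%N.
Proof.
move=> inv; pose d := face_degree st.
(* Affine in the indicator of [v] lying on the chosen face, so that averaging over [j] is linear. *)
pose G v j := F v (d v) +
  (in_face v (chosen_face st j))%:R * (F v (d v).+1 - F v (d v)).
under [LHS]eq_avg => j.
  rewrite mem_iota add0n => /andP[_ jt]; rewrite (vertex_sum_step _ inv jt).
  have -> : \sum_(v <- iota 0 (ran_nverts st))
      F v (d v + in_face v (chosen_face st j))%N =
      \sum_(v <- iota 0 (ran_nverts st)) G v j.
    apply: eq_bigr => v _; rewrite /G.
    case: in_face => /=; first by rewrite addn1 mul1r addrC subrK.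
    by rewrite addn0 mul0r addr0.
  over.
rewrite /= avgD avg_cst // avg_sum; congr (_ + _).
apply: eq_bigr => v _; rewrite /G avgD avg_cst //.
rewrite (avgMr _ (fun j => (in_face v (chosen_face st j))%:R)) (avg_in_face _ _ inv).
rewrite -/(d v); ring.
Qed.

Lemma count_in_face_le3 f (r : seq nat) : uniq r ->
  (count (in_face ^~ f) r <= 3)%N.
Proof.
move=> ur; case: f => [[a b] c]; rewrite /in_face.
have le1 x : (count (pred1 x) r <= 1)%N by rewrite count_uniq_mem // leq_b1.
have := count_predUI (pred1 b) (pred1 c) r.
have := count_predUI (pred1 a) (predU (pred1 b) (pred1 c)) r.
have -> : count (fun v => [|| v == a, v == b | v == c]) r =
  count (predU (pred1 a) (predU (pred1 b) (pred1 c))) r by [].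
have := le1 a; have := le1 b; have := le1 c; lia.
Qed.

(** The average is itself within [c] of [x], which costs a second [c] in the triangle inequality. *)
Lemma dist_avg_le (R : realType) (I : eqType) (r : seq I) (f : I -> R) (x c : R) :
  {in r, forall i, `|f i - x| <= c} -> {in r, forall i, `|f i - avg r f| <= c + c}.
Proof.
move=> fx i ir; have r0 : (0 < size r)%N by case: r ir {fx}.
rewrite -(subrK x (f i)) -addrA; apply: (le_trans (ler_normD _ _)).
apply: lerD; first exact: fx.
rewrite ler_norml; apply/andP; split.
  suff : avg r f <= x + c by lra.
  rewrite -(avg_cst (x + c) r0); apply: le_avg => j /fx; rewrite ler_norml; lra.
suff : x - c <= avg r f by lra.
rewrite -(avg_cst (x - c) r0); apply: le_avg => j /fx; rewrite ler_norml; lra.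
Qed.

(** * The expectation of the degree counts *)

Section ExpectedDegreeCount.
Variables (R : realType).

(** For inner vertices the degree is the face degree, so their mean counts satisfy a closed
    recurrence. *)
Definition inner_count (k : nat) (st : ran_state) : R :=
  \sum_(v <- iota 0 (ran_nverts st)) ((3 <= v)%N && (face_degree st v == k))%:R.

Definition mean_inner_count (k t : nat) : R :=
  avg (ran_choices t) (fun s => inner_count k (ran_run s)).

Lemma mean_inner_count0 k : mean_inner_count k 0 = 0.
Proof.
by rewrite /mean_inner_count /avg big_seq1 /inner_count !big_cons big_nil /= !addr0 mul0r.
Qed.

Lemma avg_inner_count_step k t st : ran_invariant t st ->
  avg (iota 0 (2 * t).+1) (fun j => inner_count k (ran_step st j)) =
  (1 - k%:R / (2 * t).+1%:R) * inner_count k st +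
  (k.-1)%:R / (2 * t).+1%:R * inner_count k.-1 st + (k == 3)%:R.
Proof.
move=> inv; rewrite /inner_count.
rewrite (avg_vertex_sum_step (fun v d => ((3 <= v)%N && (d == k))%:R) inv).
rewrite (ran_nvertsE inv) leq_addr [k == 3%N]eq_sym; congr (_ + _).
rewrite !mulr_sumr -big_split; apply: eq_bigr => v _ /=.
case: (3 <= v)%N; rewrite /= ?mulr0 ?addr0 //.
move: (face_degree st v) => d; case: k => [|k] /=.
  (* For [k = 0] the predecessor is 0 again, but its coefficient vanishes. *)
  by case: d => [|d]; rewrite /= ?mul0r ?mulr0 ?add0r ?addr0.
rewrite eqSS; case: (eqVneq d k.+1) => [->|_]; last first.
  by rewrite !mulr0 addr0 add0r; case: eqVneq => [->|]; rewrite ?mulr0.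
by rewrite gtn_eqF // !mulr0 add0r addr0.
Qed.

Lemma mean_inner_countS k t : mean_inner_count k t.+1 =
  (1 - k%:R / (2 * t).+1%:R) * mean_inner_count k t +
  (k.-1)%:R / (2 * t).+1%:R * mean_inner_count k.-1 t + (k == 3)%:R.
Proof.
rewrite /mean_inner_count avg_ran_choicesS.
under eq_avg => s st.
  under eq_avg do rewrite ran_run_rcons.
  rewrite (avg_inner_count_step _ (ran_invariant_run st)) addrC addrA.
  rewrite ![_ / _ * _]mulrC [_ * inner_count k _]mulrC.
  over.
rewrite /= !avgD !avgMr avg_cst ?size_ran_choices_gt0 //; ring.
Qed.

Lemma Zk_vertex_sum k t s : s \in ran_choices t ->
  (Zk k s)%:R = \sum_(v <- iota 0 (ran_nverts (ran_run s)))
    (face_degree (ran_run s) v + (v < 3) == k)%N%:R :> R.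
Proof.
move=> /ran_invariant_run inv.
rewrite /Zk -sum1_count natr_sum [LHS]big_mkcond /=.
apply: eq_big_seq => v; rewrite mem_iota add0n => /andP[_ vn].
by rewrite (ran_degreeE inv) //; case: eqP.
Qed.

Lemma Zk_inner_count k t s : s \in ran_choices t ->
  inner_count k (ran_run s) <= (Zk k s)%:R <= inner_count k (ran_run s) + 3.
Proof.
move=> st; rewrite (Zk_vertex_sum _ st) /inner_count.
rewrite (ran_nvertsE (ran_invariant_run st)); apply/andP; split.
  apply: ler_sum => v _; rewrite ler_nat [(3 <= v)%N]leqNgt.
  by case: (v < 3)%N => //=; rewrite addn0.
have -> : (3 : R) = \sum_(v <- iota 0 (3 + t)) (v < 3)%N%:R.
  rewrite iotaD big_cat /= !big_cons big_nil /= big_seq big1 ?addr0; first lra.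
  by move=> v; rewrite mem_iota [(v < 3)%N]ltnNge add0n => /andP[-> _].
rewrite -big_split; apply: ler_sum => v _ /=; rewrite -natrD ler_nat.
by rewrite [(3 <= v)%N]leqNgt; case: (v < 3)%N; rewrite /= ?addn0 // leq_b1.
Qed.

(** The constant is 6/10 from the recurrence plus 3 for the outer vertices. *)
Lemma EZk_linear k t : (3 <= k)%N -> (2 <= t)%N ->
  `|EZk R k t - degree_slope R k * t%:R| <= 36 / 10.
Proof.
move=> k3 t2.
have := degree_rec_linear mean_inner_count0 mean_inner_countS k3 t2.
have lo : mean_inner_count k t <= EZk R k t.
  by apply: le_avg => s /(Zk_inner_count k) /andP[].
have hi : EZk R k t <= mean_inner_count k t + 3.
  rewrite -[X in _ + X](avg_cst _ (size_ran_choices_gt0 t)) -avgD.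
  by apply: le_avg => s /(Zk_inner_count k) /andP[].
by rewrite ler_norml; lra.
Qed.

End ExpectedDegreeCount.

(** * Concentration through the Doob martingale *)

Section Concentration.
Variables (R : realType) (k : nat).

(* The probability that a vertex lying on [d] of the [n] faces has degree [k]
   after [m] further steps; [outer] accounts for its unbounded face. *)
Fixpoint hit_prob (outer : bool) (m n d : nat) : R :=
  match m with
  | 0 => (d + outer == k)%N%:R
  | m'.+1 => d%:R / n%:R * hit_prob outer m' n.+2 d.+1 +
             (1 - d%:R / n%:R) * hit_prob outer m' n.+2 d
  end.

Lemma hit_prob01 outer m n d : (d <= n)%N -> (0 < n)%N ->
  0 <= hit_prob outer m n d <= 1.
Proof.
elim: m n d => [|m IHm] n d dn n0 /=; first by case: eqP; rewrite ?ler01 ?lexx.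
have /andP[a0 a1] := IHm n.+2 d.+1 (leqW dn) isT.
have /andP[b0 b1] := IHm n.+2 d (leqW (leqW dn)) isT.
have p0 : 0 <= d%:R / n%:R :> R by rewrite divr_ge0.
have p1 : d%:R / n%:R <= 1 :> R by rewrite ler_pdivrMr ?ltr0n // mul1r ler_nat.
move: p0 p1; move: (d%:R / _) => p p0 p1; apply/andP; split; nra.
Qed.

(** The share of vertices not yet inserted: each starts on three faces when the number of faces is
    known, so the sum does not depend on the choices. *)
Fixpoint new_hits (m n : nat) : R :=
  if m is m'.+1 then hit_prob false m' n.+2 3 + new_hits m' n.+2 else 0.

(* The conditional expectation of the number of degree-[k] vertices
   [m] steps after reaching the state [st]. *)
Definition cond_Zk (m : nat) (st : ran_state) : R :=
  \sum_(v <- iota 0 (ran_nverts st))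
     hit_prob (v < 3)%N m (size (ran_faces st)) (face_degree st v) +
  new_hits m (size (ran_faces st)).

Lemma size_ran_faces_step t st j : ran_invariant t st -> (j < (2 * t).+1)%N ->
  size (ran_faces (ran_step st j)) = (2 * t).+3.
Proof.
by move=> inv jt; rewrite (size_ran_faces (ran_invariant_step inv jt)) mulnS.
Qed.

Lemma cond_Zk_step m t st j : ran_invariant t st -> (j < (2 * t).+1)%N ->
  cond_Zk m (ran_step st j) = \sum_(v <- iota 0 (ran_nverts (ran_step st j)))
     hit_prob (v < 3)%N m (2 * t).+3 (face_degree (ran_step st j) v) +
  new_hits m (2 * t).+3.
Proof. by move=> inv jt; rewrite /cond_Zk (size_ran_faces_step inv jt). Qed.

(** The martingale property: [hit_prob] unfolds to the summand of [avg_vertex_sum_step], and the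
    inserted vertex accounts for the first term of [new_hits]. *)
Lemma avg_cond_Zk_step m t st : ran_invariant t st ->
  avg (iota 0 (2 * t).+1) (fun j => cond_Zk m (ran_step st j)) = cond_Zk m.+1 st.
Proof.
move=> inv; under eq_avg => j.
  rewrite mem_iota add0n => /andP[_ jt]; rewrite (cond_Zk_step _ inv jt).
  over.
rewrite /= avgD avg_cst //.
rewrite (avg_vertex_sum_step (fun v => hit_prob (v < 3)%N m (2 * t).+3) inv).
rewrite /cond_Zk (size_ran_faces inv) -addrA; congr (_ + _) => /=.
by rewrite (ran_nvertsE inv) ltnNge leq_addr.
Qed.

Lemma cond_Zk_incr m t st j : ran_invariant t st -> (j < (2 * t).+1)%N ->
  `|cond_Zk m (ran_step st j) - cond_Zk m.+1 st| <= 6.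
Proof.
move=> inv jt; rewrite -(avg_cond_Zk_step _ inv).
(* The value if no present vertex gained a face. It is independent of [j], and a choice moves at
   most three terms away from it, each by at most 1; [dist_avg_le] doubles this to 6. *)
pose base : R := \sum_(v <- iota 0 (ran_nverts st))
    hit_prob (v < 3)%N m (2 * t).+3 (face_degree st v) +
  hit_prob (ran_nverts st < 3)%N m (2 * t).+3 3 + new_hits m (2 * t).+3.
have -> : (6 : R) = 3 + 3 by lra.
apply: (@dist_avg_le _ _ _ (fun j => cond_Zk m (ran_step st j)) base); last first.
  by rewrite mem_iota.
move=> {jt}j; rewrite mem_iota add0n => /andP[_ jt].
rewrite (cond_Zk_step _ inv jt).
rewrite (vertex_sum_step (fun v => hit_prob (v < 3)%N m (2 * t).+3) inv jt) /base.
set S1 := \sum_(_ <- _) _; set S2 := \sum_(_ <- _) _; set c := hit_prob _ _ _ _.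
have -> : S1 + c + new_hits m (2 * t).+3 - (S2 + c + new_hits m (2 * t).+3) =
  S1 - S2 by ring.
rewrite /S1 /S2 -sumrB; apply: (le_trans (ler_norm_sum _ _ _)).
have := count_in_face_le3 (chosen_face st j) (iota_uniq 0 (ran_nverts st)).
rewrite -(ler_nat R); apply: le_trans.
rewrite -sum1_count natr_sum [leRHS]big_mkcond /=; apply: ler_sum => v _.
case: in_face; last by rewrite addn0 subrr normr0.
have dn : (face_degree st v <= (2 * t).+1)%N.
  by rewrite -(size_ran_faces inv) count_size.
have := @hit_prob01 (v < 3)%N m (2 * t).+3 (face_degree st v + 1) ltac:(lia) isT.
have := @hit_prob01 (v < 3)%N m (2 * t).+3 (face_degree st v) ltac:(lia) isT.
by rewrite ler_norml; lra.
Qed.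

Lemma cond_Zk0 t s : s \in ran_choices t -> cond_Zk 0 (ran_run s) = (Zk k s)%:R.
Proof. by move=> st; rewrite (Zk_vertex_sum _ _ st) /cond_Zk /= addr0. Qed.

Lemma Zk_concentration t (lambda : R) : 0 < lambda ->
  ran_prob R t (fun s => lambda <= `|(Zk k s)%:R - EZk R k t|) <=
  2 * expR (- (lambda ^+ 2 / (72 * t%:R))).
Proof.
(* At [t = 0] division by zero gives exponent 0, and the bound is the trivial 2. *)
move=> l0; case: (posnP t) => [->|t0].
  rewrite mulr0 invr0 mulr0 oppr0 expR0 mulr1 ran_probE.
  apply: (@le_trans _ _ (avg (ran_choices 0) (fun=> 1 : R))).
    by apply: le_avg => s _; rewrite lern1 leq_b1.
  by rewrite avg_cst // ler1n.
(* The conditional expectation of [Zk] at time [t] given the first [i] choices; it runs from [EZk]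
   to [Zk]. *)
pose M i s := cond_Zk (t - i) (ran_run s).
have mart i s : (i < t)%N -> s \in ran_choices i ->
    avg (iota 0 (2 * i).+1) (fun j => M i.+1 (rcons s j)) = M i s.
  move=> it si; rewrite /M -(subnSK it) -(avg_cond_Zk_step _ (ran_invariant_run si)).
  by apply: eq_avg => j _; rewrite ran_run_rcons.
have incr i s j : (i < t)%N -> s \in ran_choices i -> (j < (2 * i).+1)%N ->
    `|M i.+1 (rcons s j) - M i s| <= 6.
  move=> it si ji; rewrite /M -(subnSK it) ran_run_rcons.
  exact: cond_Zk_incr (ran_invariant_run si) ji.
have MZ : {in ran_choices t, forall s, M t s = (Zk k s)%:R}.
  by move=> s st; rewrite /M subnn (cond_Zk0 st).
have EZ : EZk R k t = M 0 [::].
  rewrite -(martingale_avg mart (leqnn t)).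
  by apply: eq_avg => s st; rewrite MZ.
have := azuma t0 (ltr0n R 6) l0 mart incr.
have -> : 2 * 6 ^+ 2 = 72 :> R by ring.
apply: le_trans; rewrite !ran_probE; apply: le_avg => s st.
by rewrite MZ // EZ.
Qed.

End Concentration.

Theorem theorem1 (R : realType) :
  (forall k : nat, (3 <= k)%N ->
     exists b : R, exists T : nat, forall t : nat, (T <= t)%N ->
       `| EZk R k t - b * t%:R | <= 36 / 10)
  /\
  (forall (lambda : R) (k t : nat), 0 < lambda -> (3 <= k)%N ->
     ran_prob R t (fun s => lambda <= `| (Zk k s)%:R - EZk R k t |)
       <= 2 * expR (- (lambda ^+ 2 / (72 * t%:R)))).
Proof.
split=> [k k3|lambda k t l0 _]; last exact: Zk_concentration.
by exists (degree_slope R k), 2%N => t t2; exact: EZk_linear.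
Qed.
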